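(* Let $\psi: T \to \mathbb{C}$ be a function for which $M_\psi$ is bounded on $L_\mu^\infty$. The following are equivalent: (1) $M_\psi$ is Fredholm (on $L_\mu^\infty$); (2) $Z = \{v \in T : \psi(v) = 0\}$ is finite and $\inf_{v \in Z^c} |\psi(v)| > 0$, where $Z^c = T \setminus Z$; (3) there exist $\varepsilon > 0$ and $N \in \mathbb{N}$ such that $|\psi(v)| \ge \varepsilon$ for all $v \in T$ with $|v| > N$.
   Context: $(T,\mathrm{d})$ is a metric space with a distinguished point $o$ (the root); the length of $v \in T$ is $|v| = \mathrm{d}(o,v)$. $T$ is assumed locally finite (for every $M>0$ the set $\{v \in T : |v| < M\}$ is finite) and unbounded (for every $M>0$ there is $v \in T$ with $|v| \ge M$). $\mu: T \to (0,\infty)$ is an arbitrary positive function (a weight). $L_\mu^\infty$ is the Banach space of functions $f: T \to \mathbb{C}$ with $\|f\|_\mu = \sup_{v \in T} \mu(v)|f(v)| < \infty$. The multiplication operator is the linear map $M_\psi f = \psi f$; it is bounded on $L_\mu^\infty$ if it is a bounded operator from $L_\mu^\infty$ to itself. A bounded operator $A$ on a Banach space is Fredholm if it has closed range and both $\ker(A)$ and $\ker(A^* )$ are finite dimensional, where $A^*$ is the adjoint on the dual space; equivalently, there is a bounded operator $S$ such that $SA - I$ and $AS - I$ are both compact. *)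

(* Defs.v *)
From HB Require Import structures.
From mathcomp Require Import all_boot all_order all_algebra.
From mathcomp Require Import all_classical all_reals.
From mathcomp Require Import interval_inference ereal topology normedtype complex.

Set Implicit Arguments.
Unset Strict Implicit.
Unset Printing Implicit Defensive.

Import Order.TTheory GRing.Theory Num.Theory.
Import numFieldNormedType.Exports.
Import ComplexField.Normc.

Local Open Scope classical_set_scope.
Local Open Scope ring_scope.

Section RootedMetricSpace.
Variables (R : realType) (T : metricType R) (o : T).

Definition rlength (v : T) : R := mdist o v.

Definition locally_finite : Prop :=
  forall M : R, 0 < M -> finite_set [set v | rlength v < M].

Definition unbounded : Prop :=
  forall M : R, 0 < M -> exists v, M <= rlength v.

End RootedMetricSpace.

Section Fredholm.
Variable K : numFieldType.

(* Norms take values in K. When K is a field of complex numbers, the inequality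
   includes that C * `|x| is real. *)
Definition bounded_operator (V W : normedModType K) (A : V -> W) : Prop :=
  linear A /\ exists C : K, forall x : V, `|A x| <= C * `|x|.

Definition finite_dimensional (V : lmodType K) (W : set V) : Prop :=
  exists (n : nat) (e : 'I_n -> V),
    W = [set \sum_(i < n) c i *: e i | c in [set: 'I_n -> K]].

Definition kernel (V W : lmodType K) (A : V -> W) : set V := [set x | A x = 0].

(* A functional is kept as a plain function V -> K^o, so that the vector space
   structure is the pointwise one of the library. *)
Definition dual (V : normedModType K) : set (V -> K^o) :=
  [set phi | bounded_operator phi].

Definition adjoint (V W : normedModType K) (A : V -> W) (phi : W -> K^o) :
  V -> K^o := phi \o A.

Arguments dual V : clear implicits.

Definition fredholm (V : completeNormedModType K) (A : V -> V) : Prop :=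
  [/\ bounded_operator A,
      closed (range A),
      finite_dimensional (kernel A) &
      finite_dimensional (dual V `&` kernel (adjoint A))].

End Fredholm.

Section WeightedLinf.
Variables (R : realType) (T : Type) (mu : T -> {posnum R}).

(* normc is the modulus of a complex number as an element of R. *)
Definition weighted (f : T -> R[i]) : set R :=
  range (fun v => (mu v)%:num * normc (f v)).

Definition Linf_pred : pred (T -> R[i]) := fun f => `[< has_ubound (weighted f) >].

Record Linf : Type := MkLinf {
  Linf_fun :> T -> R[i] ;
  Linf_funP : Linf_fun \in Linf_pred }.

HB.instance Definition _ := [isSub for Linf_fun].
HB.instance Definition _ := [Choice of Linf by <:].

Lemma normcE (z : R[i]) : `|z| = (normc z)%:C%C.
Proof. by []. Qed.

Lemma normc_ge0 (z : R[i]) : 0 <= normc z.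
Proof. by rewrite -lecR -normcE normr_ge0. Qed.

Lemma normcD (x y : R[i]) : normc (x + y) <= normc x + normc y.
Proof. by rewrite -lecR rmorphD /= -!normcE ler_normD. Qed.

Lemma normc_opp (x : R[i]) : normc (- x) = normc x.
Proof. by apply: complexI; rewrite -!normcE normrN. Qed.

Lemma LinfP (f : T -> R[i]) : reflect
  (exists M : R, forall v, (mu v)%:num * normc (f v) <= M) (f \in Linf_pred).
Proof.
apply: (iffP (asboolP (has_ubound (weighted f)))) => -[M fM]; exists M.
  by move=> v; apply: fM; exists v.
by move=> _ [v _ <-].
Qed.

Lemma Linf_submod : submod_closed Linf_pred.
Proof.
split; first by apply/LinfP; exists 0 => v; rewrite normc0 mulr0.
move=> a f g /LinfP[M fM] /LinfP[N gN]; apply/LinfP.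
exists (normc a * M + N) => v.
apply: (@le_trans _ _ (normc a * ((mu v)%:num * normc (f v)) +
                       (mu v)%:num * normc (g v))).
  by rewrite mulrCA -mulrDr ler_wpM2l // -normcM normcD.
by rewrite lerD // ler_wpM2l ?normc_ge0.
Qed.

HB.instance Definition _ := GRing.isSubmodClosed.Build _ _ Linf_pred Linf_submod.
HB.instance Definition _ := [SubChoice_isSubLmodule of Linf by <:].

(* If T is empty then this is 0, as sup set0 = 0. *)
Definition Linf_norm (f : Linf) : R := sup (weighted f).

Lemma Linf_norm_ub (f : Linf) v : (mu v)%:num * normc (f v) <= Linf_norm f.
Proof.
apply: ub_le_sup; last by exists v.
by have /asboolP := Linf_funP f.
Qed.

Lemma Linf_norm_le (f : Linf) (M : R) : 0 <= M ->
  (forall v, (mu v)%:num * normc (f v) <= M) -> Linf_norm f <= M.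
Proof.
move=> M0 fM; rewrite /Linf_norm; have [->|f0] := eqVneq (weighted f) set0.
  by rewrite sup0.
by apply: ge_sup; [exact/set0P|move=> _ [v _ <-]].
Qed.

Lemma Linf_norm_ge0 (f : Linf) : 0 <= Linf_norm f.
Proof.
rewrite /Linf_norm; have [->|/set0P[_ [v _ _]]] := eqVneq (weighted f) set0.
  by rewrite sup0.
by apply: le_trans (Linf_norm_ub f v); rewrite mulr_ge0 ?normc_ge0.
Qed.

Definition Linf_normC (f : Linf) : R[i] := (Linf_norm f)%:C%C.

Lemma Linf_ler_normD f g : Linf_normC (f + g) <= Linf_normC f + Linf_normC g.
Proof.
rewrite /Linf_normC -rmorphD lecR; apply: Linf_norm_le => [|v].
  by rewrite addr_ge0 ?Linf_norm_ge0.
apply: le_trans (lerD (Linf_norm_ub f v) (Linf_norm_ub g v)).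
by rewrite -mulrDr ler_wpM2l // normcD.
Qed.

Lemma Linf_normr0_eq0 f : Linf_normC f = 0 -> f = 0.
Proof.
move=> /complexI f0; apply/val_inj/funext => v /=; apply: eq0_normc.
have := Linf_norm_ub f v; rewrite f0 pmulr_rle0 // => fv.
by apply/eqP; rewrite eq_le fv normc_ge0.
Qed.

Lemma Linf_normrZ (a : R[i]) f : Linf_normC (a *: f) = `|a| * Linf_normC f.
Proof.
have le b g : Linf_norm (b *: g) <= normc b * Linf_norm g.
  apply: Linf_norm_le => [|v]; first by rewrite mulr_ge0 ?normc_ge0 ?Linf_norm_ge0.
  rewrite [X in normc X]/(b * g v) normcM mulrCA.
  by rewrite ler_wpM2l ?normc_ge0 // Linf_norm_ub.
rewrite /Linf_normC normcE -rmorphM; congr (_ %:C)%C.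
apply/eqP; rewrite eq_le le /=; have [->|a0] := eqVneq a 0.
  by rewrite normc0 mul0r Linf_norm_ge0.
have na0 : 0 < normc a.
  rewrite lt_def normc_ge0 andbT; apply: contra a0 => /eqP/eq0_normc ->.
  exact: eqxx.
have := le a^-1 (a *: f); rewrite scalerA mulVf // scale1r normcV.
by rewrite ler_pdivlMl.
Qed.

HB.instance Definition _ := Lmodule_isNormed.Build R[i] Linf
  Linf_ler_normD Linf_normrZ Linf_normr0_eq0.

Lemma Linf_normE (f : Linf) : `|f| = (Linf_norm f)%:C%C.
Proof. by []. Qed.

Lemma ge_normc_Re (z : R[i]) : `|complex.Re z| <= normc z.
Proof. by rewrite -lecR -normcE normc_ge_Re. Qed.

Lemma ge_normc_Im (z : R[i]) : `|complex.Im z| <= normc z.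
Proof.
rewrite -sqrtr_sqr; case: z => a b /=.
by rewrite ler_wsqrtr // lerDr sqr_ge0.
Qed.

Lemma le_normcReIm (z : R[i]) : normc z <= `|complex.Re z| + `|complex.Im z|.
Proof.
case: z => a b /=; rewrite -[leRHS]ger0_norm ?addr_ge0 // -sqrtr_sqr.
rewrite ler_wsqrtr // sqrrD !real_normK ?num_real // lerD2r lerDl.
by rewrite mulrn_wge0 // mulr_ge0.
Qed.

Lemma Linf_ballP (f g : Linf) (e : R) : ball f e%:C%C g ->
  forall v, (mu v)%:num * normc (f v - g v) <= e.
Proof.
rewrite -ball_normE /ball_ /= Linf_normE ltcR => /ltW fg v.
exact: le_trans (Linf_norm_ub (f - g) v) fg.
Qed.

Lemma Linf_complete (F : set_system Linf) :
  ProperFilter F -> cauchy F -> cvg F.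
Proof.
move=> FF /cauchyP Fc.
have Fc' (e : R) : 0 < e -> exists f0 : Linf, F [set f : Linf |
    forall v, (mu v)%:num * normc (f0 v - f v) <= e].
  move=> e0; have [|f0 Ff0] := Fc e%:C%C; first by rewrite ltcR.
  by exists f0; apply: filterS Ff0 => f; exact: Linf_ballP.
have cvgR (h : R[i] -> R) : {morph h : x y / x - y} ->
    (forall z, `|h z| <= normc z) ->
    forall v, cvg ((fun f : Linf => h (f v)) @ F).
  move=> hB hle v; apply: cauchy_cvg; apply/cauchy_exP => e e0.
  have [|f0 Ff0] := Fc' ((mu v)%:num * (e / 2)).
    by rewrite mulr_gt0 // divr_gt0.
  exists (h (f0 v)); change (F [set f : Linf | ball (h (f0 v)) e (h (f v))]).
  apply: filterS Ff0 => f /= /(_ v).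
  rewrite ler_pM2l // => f0f; rewrite -ball_normE /= -hB.
  apply: le_lt_trans (hle _) (le_lt_trans f0f _).
  by rewrite ltr_pdivrMr // ltr_pMr // ltr1n.
have cRe v := cvgR (@complex.Re R) (fun x y => raddfB _ x y) ge_normc_Re v.
have cIm v := cvgR (@complex.Im R) (fun x y => raddfB _ x y) ge_normc_Im v.
pose g v : R[i] := (lim ((fun f : Linf => complex.Re (f v)) @ F) +i*
                    lim ((fun f : Linf => complex.Im (f v)) @ F))%C.
have gF v (d : R) : 0 < d ->
    F [set f : Linf | (mu v)%:num * normc (g v - f v) <= d].
  move=> d0; pose d' := (mu v)%:num^-1 * (d / 2).
  have d'0 : 0 < d' by rewrite mulr_gt0 // divr_gt0.
  have /cvgrPdist_le/(_ _ d'0) FRe := cRe v.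
  have /cvgrPdist_le/(_ _ d'0) FIm := cIm v.
  apply: filterS2 FRe FIm => f /= fRe fIm.
  rewrite -ler_pdivlMl //; apply: le_trans (le_normcReIm _) _.
  rewrite !raddfB /=; apply: le_trans (lerD fRe fIm) _.
  by rewrite /d' -mulrDr -splitr.
have gF' (f0 : Linf) (e : R) : F [set f : Linf |
    forall v, (mu v)%:num * normc (f0 v - f v) <= e] ->
    forall v, (mu v)%:num * normc (g v - f0 v) <= e.
  move=> Ff0 v; apply/ler_addgt0Pr => d d0.
  have [f [/= gf /(_ v) ff0]] := filter_ex (filterI (gF v d d0) Ff0).
  apply: (le_trans _ (lerD ff0 gf)).
  rewrite -mulrDr ler_wpM2l //.
  rewrite -[in leRHS](normc_opp (f0 v - f v)) opprB.
  by apply: (le_trans _ (normcD _ _)); rewrite [in leRHS]addrC addrA subrK.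
have gP : g \in Linf_pred.
  have [f0 /gF' gf0] := Fc' 1 ltr01.
  apply/LinfP; exists (1 + Linf_norm f0) => v.
  apply: (le_trans _ (lerD (gf0 v) (Linf_norm_ub f0 v))).
  rewrite -mulrDr ler_wpM2l //.
  by apply: (le_trans _ (normcD _ _)); rewrite subrK.
apply/cvg_ex; exists (MkLinf gP); apply/cvgrPdist_le => /= e e0.
have [eE re0] : e = (complex.Re e)%:C%C /\ 0 < complex.Re e.
  by case: e e0 => x y; rewrite ltcE /= => /andP[/eqP -> ->].
have e20 : 0 < complex.Re e / 2 by rewrite divr_gt0.
have [f0 Ff0] := Fc' _ e20.
have gf0 := gF' _ _ Ff0; apply: filterS Ff0 => f f0f.
rewrite Linf_normE eE lecR; apply: Linf_norm_le; first exact: ltW.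
move=> v; rewrite [leRHS]splitr; apply: (le_trans _ (lerD (gf0 v) (f0f v))).
rewrite -mulrDr ler_wpM2l //.
by apply: (le_trans _ (normcD _ _)); rewrite addrA subrK.
Qed.

HB.instance Definition _ := Uniform_isComplete.Build Linf Linf_complete.

Definition zero_set (psi : T -> R[i]) : set T := [set v | psi v = 0].

Definition stable_under_mult (psi : T -> R[i]) : Prop :=
  forall f : Linf, psi \* f \in Linf_pred.

Definition mult_operator (psi : T -> R[i]) (psiL : stable_under_mult psi) :
  Linf -> Linf := fun f => MkLinf (psiL f).

End WeightedLinf.

(* Main.v *)
(* If [M_psi] has closed range, let [g] be [psi / (mu |psi|^(1/2))] on [{0 < |psi| <= 1}] and 0
   elsewhere. Its truncations to [{|psi| >= d}] are in the range and converge to [g] as [d]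
   tends to 0, so [g = psi f] for some [f] in [L_mu^oo]. Then [mu |f| = |psi|^(-1/2)] is bounded
   on [{0 < |psi| <= 1}], which bounds [|psi|] away from 0 off its zeros, without the open
   mapping theorem. The zeros are finitely many as their indicators are independent elements
   of the kernel. Conversely, under (2) the range is the set of functions vanishing on [Z],
   the kernel is spanned by the indicators of the points of [Z], and the kernel of the adjoint
   by the evaluations at these points. *)
From HB Require Import structures.
Require Import Defs.
From mathcomp Require Import all_boot all_order all_algebra.
From mathcomp Require Import all_classical all_reals.
From mathcomp Require Import interval_inference ereal topology normedtype complex.

Import Order.TTheory GRing.Theory Num.Theory.
Import numFieldNormedType.Exports.
Import ComplexField.Normc.

Local Open Scope classical_set_scope.
Local Open Scope ring_scope.

(** * Positive lower bounds and linear dependence *)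

Lemma ereal_inf_gt0P (R : realType) (T : Type) (A : set T) (h : T -> R) :
  (0 < ereal_inf [set (h v)%:E | v in A])%E <->
  exists2 d : R, 0 < d & forall v, A v -> d <= h v.
Proof.
split=> [|[d d0 dh]]; last first.
  apply: (@lt_le_trans _ _ d%:E); first by rewrite lte_fin.
  by apply: le_ereal_inf_tmp => _ [v Av <-]; rewrite lee_fin dh.
have lb v : A v -> (ereal_inf [set (h v)%:E | v in A] <= (h v)%:E)%E.
  by move=> Av; apply: ereal_inf_lbound; exists v.
case: (ereal_inf _) lb => [r||] //= lb.
  by rewrite lte_fin => r0; exists r => // v /lb; rewrite lee_fin.
(* The infimum is [+oo] only for empty [A], so any positive constant serves. *)
by move=> _; exists 1 => // v /lb; rewrite leye_eq.
Qed.

Lemma finite_set_pos_lower_bound (R : realType) (T : choiceType) (A : set T)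
    (h : T -> R) :
  finite_set A -> (forall v, A v -> 0 < h v) ->
  exists2 d : R, 0 < d & forall v, A v -> d <= h v.
Proof.
move=> /finite_seqP[s ->]; elim: s => [|x s IH] h0; first by exists 1.
have [v vs|d d0 dh] := IH; first by apply: h0; rewrite /= inE vs orbT.
exists (Num.min d (h x)) => [|v /=].
  by rewrite lt_min d0 h0 //= mem_head.
by rewrite inE ge_min => /predU1P[->|/dh ->//]; rewrite lexx orbT.
Qed.

(** The coordinates of [n.+1] vectors over [n] generators form a matrix with more rows than columns,
    so its rows are dependent. *)
Lemma finite_dimensional_dependent (K : numFieldType) (V : lmodType K)
    (W : set V) (x : nat -> V) :
  finite_dimensional W -> (forall i, W (x i)) ->
  exists (m : nat) (u : 'I_m -> K) (i : 'I_m),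
    \sum_(j < m) u j *: x j = 0 /\ u i != 0.
Proof.
move=> [n [e We]] Wx.
have xe i : exists c : 'I_n -> K, \sum_(j < n) c j *: e j = x i.
  by have := Wx i; rewrite We => -[c _ cE]; exists c.
have [c cE] := choice xe.
pose A := \matrix_(i < n.+1, j < n) c i j.
apply: contrapT => indep; suff : row_free A.
  by rewrite -row_leq_rank leqNgt ltnS rank_leq_col.
apply: inj_row_free => u uA0; apply/rowP => i; rewrite mxE.
apply: contrapT => /eqP ui; apply: indep; exists n.+1, (u 0), i; split => //.
under eq_bigr do rewrite -cE scaler_sumr.
rewrite exchange_big big1// => k _.
under eq_bigr do rewrite scalerA.
rewrite -scaler_suml; have /rowP/(_ k) := uA0; rewrite !mxE => uAk.
rewrite (_ : \sum_i _ = 0) ?scale0r// -[RHS]uAk.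
by apply: eq_bigr => j _; rewrite mxE.
Qed.

Lemma normc_gt0 (R : realType) (z : R[i]) : (0 < normc z) = (z != 0).
Proof. by rewrite -ltcR -Defs.normcE normr_gt0. Qed.

Lemma normc_real (R : realType) (x : R) : normc x%:C%C = `|x|.
Proof. by rewrite /= expr0n addr0 sqrtr_sqr. Qed.

(** * Closure and indicators in the weighted space *)

Section MultiplicationOperator.
Context {R : realType} {T : choiceType} {mu : T -> {posnum R}}.
Local Notation L := (Linf mu).

Lemma Linf_fun_comb (n : nat) (c : 'I_n -> R[i]) (f : 'I_n -> L) v :
  (\sum_(i < n) c i *: f i : L) v = \sum_(i < n) c i * f i v.
Proof.
pose ev (g : L) := g v; rewrite -[LHS]/(ev _).
by rewrite (big_morph ev (id1 := 0) (op1 := +%R)).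
Qed.

Lemma closure_LinfP (A : set L) (f : L) : closure A f <->
  forall e : R, 0 < e ->
    exists2 g, A g & forall v, (mu v)%:num * normc (f v - g v) <= e.
Proof.
split=> [Af e e0|Af B /nbhs_ballP[e /= e0 eB]].
  have [|g [Ag fg]] := Af (ball f e%:C%C).
    by apply: nbhsx_ballx; rewrite ltcR.
  by exists g => //; exact: Linf_ballP.
(* Radii live in [R[i]], where positivity forces a zero imaginary part. Half the radius is used
   below because pointwise bounds give only a weak inequality on the supremum. *)
have [eE re0] : e = (complex.Re e)%:C%C /\ 0 < complex.Re e.
  by case: e e0 {eB} => x y; rewrite ltcE /= => /andP[/eqP -> ->].
have [|g Ag fg] := Af (complex.Re e / 2); first by rewrite divr_gt0.
exists g; split => //; apply: eB; rewrite -ball_normE /ball_ /= eE.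
rewrite Linf_normE ltcR (@le_lt_trans _ _ (complex.Re e / 2)) //.
  by apply: Linf_norm_le => //; rewrite ltW// divr_gt0.
by rewrite ltr_pdivrMr// ltr_pMr// ltr1n.
Qed.

Lemma Linf_fun_le (f : L) v : normc (f v) <= (mu v)%:num^-1 * Linf_norm f.
Proof. by rewrite ler_pdivlMl// Linf_norm_ub. Qed.

Lemma indicator_Linf (v : T) : (fun w => (w == v)%:R : R[i]) \in Linf_pred mu.
Proof.
apply/LinfP; exists (mu v)%:num => w; have [->|_] := eqVneq w v.
  by rewrite normc1 mulr1.
by rewrite normc0 mulr0.
Qed.

Definition indicator (v : T) : L := MkLinf (indicator_Linf v).

Lemma sum_indicator (s : seq T) (c : 'I_(size s) -> R[i]) i :
  uniq s ->
  (\sum_(j < size s) c j *: indicator (tnth (in_tuple s) j) : L)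
    (tnth (in_tuple s) i) = c i.
Proof.
move=> us; rewrite Linf_fun_comb (bigD1 i)//= eqxx mulr1 big1 ?addr0// => j ji.
by rewrite (inj_eq (elimT (tuple_uniqP (in_tuple s)) us)) eq_sym (negPf ji) mulr0.
Qed.

Lemma sum_indicator_notin (s : seq T) (c : 'I_(size s) -> R[i]) v :
  v \notin s ->
  (\sum_(j < size s) c j *: indicator (tnth (in_tuple s) j) : L) v = 0.
Proof.
move=> vs; rewrite Linf_fun_comb big1// => j _ /=; case: eqP => [vE|]; last first.
  by rewrite mulr0.
by move: vs; rewrite vE mem_tnth.
Qed.

(** * Necessity: finite kernel and closed range *)

Section Operator.
Context {psi : T -> R[i]}.
Variable psi_stable : stable_under_mult mu psi.
Local Notation M := (mult_operator psi_stable).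

Lemma mult_operatorE f v : M f v = psi v * f v.
Proof. by []. Qed.

Lemma kernel_multP (f : L) :
  kernel M f <-> forall v, psi v != 0 -> f v = 0.
Proof.
split=> [Mf0 v psiv|f0].
  have /(congr1 (fun g : L => g v))/eqP := Mf0.
  by rewrite mult_operatorE mulf_eq0 (negPf psiv) => /eqP.
apply/val_inj/funext => v; rewrite -[LHS]/(psi v * f v).
by have [->|/f0 ->] := eqVneq (psi v) 0; rewrite ?mul0r ?mulr0.
Qed.

Lemma kernel_mult_finite :
  finite_dimensional (kernel M) -> finite_set (zero_set psi).
Proof.
move=> kfin; apply: contrapT => /infiniteP/card_leP[x].
(* [x] is an injection between subtypes; [y] is the underlying sequence of distinct zeros. *)
pose y n : T := \val (x (SigSub (mem_setT n))).
have y0 n : zero_set psi (y n) by apply: set_mem; exact: valP.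
have y_inj : injective y.
  by move=> m n /val_inj/inj; rewrite !inE => /(_ I I)[].
have [|m [u [i [/(congr1 (fun g : L => g (y i))) uy /eqP[]]]]] :=
  @finite_dimensional_dependent _ _ _ (fun n => indicator (y n)) kfin.
  move=> n; apply/kernel_multP => v /= psiv; case: eqP => // vE.
  by move: psiv; rewrite vE y0 eqxx.
(* Evaluating the dependence at [y i] leaves only the coefficient [u i]. *)
rewrite -[RHS]uy Linf_fun_comb (bigD1 i)//= eqxx mulr1 big1 ?addr0// => j ji.
by rewrite (inj_eq y_inj) -[_ == _ :> nat]/(i == j) eq_sym (negPf ji) mulr0.
Qed.

Lemma closed_range_mult_lower_bound : closed (range M) ->
  exists2 d : R, 0 < d & forall v, psi v != 0 -> d <= normc (psi v).
Proof.
move=> Mcl.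
(* [a] is the formal preimage of [g], possibly unbounded in weighted norm. It is 0 at the zeros of
   [psi], as the inverse of 0 is 0. *)
pose a v : R[i] := ((mu v)%:num^-1 * (Num.sqrt (normc (psi v)))^-1)%:C%C.
have na v : (mu v)%:num * normc (a v) = (Num.sqrt (normc (psi v)))^-1.
  rewrite normc_real ger0_norm ?mulr_ge0 ?invr_ge0 ?sqrtr_ge0//.
  by rewrite mulrA divff// mul1r.
have npa v : (mu v)%:num * normc (psi v * a v) = Num.sqrt (normc (psi v)).
  rewrite normcM mulrCA na -[in X in X / _](sqr_sqrtr (normc_ge0 (psi v))).
  have [->|s0] := eqVneq (Num.sqrt (normc (psi v))) 0.
    by rewrite expr0n mul0r.
  by rewrite expr2 mulfK.
pose g v := if normc (psi v) <= 1 then psi v * a v else 0.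
have gL : g \in Linf_pred mu.
  apply/LinfP; exists 1 => v; rewrite /g; case: ifP => psi1.
    by rewrite npa -sqrtr1 ler_wsqrtr.
  by rewrite normc0 mulr0.
have [f _ fg] : range M (MkLinf gL).
  apply: Mcl; apply/closure_LinfP => e e0.
  (* The cutoff [e ^+ 2] bounds [mu |fe|] by [e^-1], and where it removes [a] the weighted error is
     [sqrt |psi| < e]. *)
  pose fe v := if e ^+ 2 <= normc (psi v) <= 1 then a v else 0.
  have feL : fe \in Linf_pred mu.
    apply/LinfP; exists e^-1 => v; rewrite /fe; case: ifP => [/andP[epsi _]|_].
      rewrite na lef_pV2 ?posrE// ?sqrtr_gt0.
        by rewrite -[leLHS](ger0_norm (ltW e0)) -sqrtr_sqr ler_wsqrtr.
      by apply: lt_le_trans epsi; rewrite exprn_gt0.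
    by rewrite normc0 mulr0 invr_ge0 ltW.
  exists (M (MkLinf feL)); first by exists (MkLinf feL).
  move=> v; rewrite mult_operatorE /= /g /fe.
  case: (leP (normc (psi v)) 1) => psi1; last first.
    by rewrite andbF mulr0 subr0 normc0 mulr0 ltW.
  rewrite andbT; case: (leP (e ^+ 2)) => [_|psie]; first by rewrite subrr normc0 mulr0 ltW.
  rewrite mulr0 subr0 npa -[leRHS](ger0_norm (ltW e0)) -sqrtr_sqr.
  by rewrite ler_wsqrtr// ltW.
(* Adding 1 keeps [C] invertible even if [f = 0]. *)
pose C := Linf_norm f + 1.
have C0 : 0 < C by rewrite ltr_wpDl ?Linf_norm_ge0.
exists (Num.min 1 (C ^- 2)) => [|v psiv].
  by rewrite lt_min ltr01 invr_gt0 exprn_gt0.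
rewrite ge_min; case: (leP 1 (normc (psi v))) => //= psi1.
have /(congr1 (fun h : L => h v)) := fg.
(* Cancelling [psi v] identifies [f v] with [a v], whose weighted modulus [|psi v|^(-1/2)] is
   therefore at most [C]. *)
rewrite mult_operatorE /= /g ltW// => /(mulfI psiv) fv.
have s0 : 0 < Num.sqrt (normc (psi v)) by rewrite sqrtr_gt0 normc_gt0.
have Cs : C^-1 <= Num.sqrt (normc (psi v)).
  rewrite -[leRHS]invrK lef_pV2 ?posrE ?invr_gt0//.
  by rewrite -na -fv (le_trans (Linf_norm_ub f v))// lerDl.
rewrite -[leRHS](sqr_sqrtr (normc_ge0 _)) -exprVn.
by rewrite ler_pXn2r// nnegrE ltW// invr_gt0.
Qed.

(** * Sufficiency: finitely many zeros, [psi] bounded below elsewhere *)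

Section BoundedBelow.
Variables (s : seq T) (d : R).
Hypotheses (s_uniq : uniq s) (d_gt0 : 0 < d).
Hypothesis psi_zeros : forall v, (psi v == 0) = (v \in s).
Hypothesis psi_ge : forall v, psi v != 0 -> d <= normc (psi v).

Local Notation x := (tnth (in_tuple s)).

(** The preimage is [g / psi]: off the zeros the lower bound [d] controls it, and at the zeros
    division by 0 yields 0. *)
Lemma range_multP (g : L) : range M g <-> forall v, v \in s -> g v = 0.
Proof.
split=> [[f _ <-] v|g0].
  by rewrite -psi_zeros mult_operatorE => /eqP ->; rewrite mul0r.
have gL : (fun v => g v / psi v) \in Linf_pred mu.
  apply/LinfP; exists (d^-1 * Linf_norm g) => v.
  rewrite normcM normcV mulrA mulrC ler_pM ?invr_ge0 ?mulr_ge0 ?normc_ge0//.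
    have [psi0|/[dup] psiv /psi_ge dv] := eqVneq (psi v) 0.
      by rewrite psi0 normc0 invr0 invr_ge0 ltW.
    by rewrite lef_pV2 // posrE normc_gt0.
  exact: Linf_norm_ub.
exists (MkLinf gL) => //; apply/val_inj/funext => v.
rewrite -[LHS]/(psi v * (g v / psi v)); have [psi0|psiv] := eqVneq (psi v) 0.
  by rewrite psi0 mul0r; apply/esym/g0; rewrite -psi_zeros psi0.
by rewrite mulrC divfK.
Qed.

(** Vanishing at a point passes to norm limits since the weight there is positive. *)
Lemma closed_range_mult : closed (range M).
Proof.
move=> g /closure_LinfP gM; apply/range_multP => v vs; apply: eq0_normc.
apply/eqP; rewrite eq_le normc_ge0 andbT.
rewrite -(pmulr_rle0 _ (gt0 (mu v))); apply/ler_addgt0Pr => e e0; rewrite add0r.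
have [h /range_multP/(_ v vs) hv /(_ v)] := gM e e0.
by rewrite hv subr0.
Qed.

(** The indicators of the zeros span a complement of the range, so a functional killing the range is
    determined by its values on them. *)
Lemma Linf_vanishing_decomposition (f : L) :
  range M (f - \sum_(i < size s) f (x i) *: indicator (x i)).
Proof.
apply/range_multP => v vs.
rewrite -[LHS]/(f v - (\sum_(j < size s) f (x j) *: indicator (x j) : L) v).
by have /(tnthP (in_tuple s))[i ->] := vs; rewrite sum_indicator// subrr.
Qed.

Lemma finite_dimensional_kernel_mult : finite_dimensional (kernel M).
Proof.
exists (size s), (fun i => indicator (x i)); apply/seteqP; split=> f.
  move=> /kernel_multP f0; exists (f \o x) => //; apply/val_inj/funext => v /=.
  have [vs|vs] := boolP (v \in s).
    by have /(tnthP (in_tuple s))[i ->] := vs; rewrite sum_indicator.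
  by rewrite sum_indicator_notin// f0// psi_zeros.
move=> [c _ <-]; apply/kernel_multP => v psiv.
by rewrite sum_indicator_notin// -psi_zeros.
Qed.

Lemma finite_dimensional_kernel_adjoint_mult :
  finite_dimensional (@dual _ L `&` kernel (adjoint M)).
Proof.
exists (size s), (fun i (f : L) => f (x i) : R[i]^o).
apply/seteqP; split=> [phi [[phi_lin _] phiM]|phi [c _ <-]].
  pose phiL : {linear L -> R[i]^o} :=
    HB.pack phi (GRing.isLinear.Build _ _ _ _ phi phi_lin).
  exists (fun i => phi (indicator (x i))) => //; apply/funext => f.
  have [k _ kE] := Linf_vanishing_decomposition f.
  have : phiL (f - \sum_(i < size s) f (x i) *: indicator (x i)) = 0.
    by rewrite -kE; exact: (congr1 (fun h => h k) phiM).
  rewrite linearB linear_sum => /eqP; rewrite subr_eq0 => /eqP phiE.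
  rewrite -[RHS]/(phiL f) phiE fct_sumE; apply: eq_bigr => i _.
  by rewrite linearZ [RHS]mulrC.
have sumE f : (\sum_(i < size s) c i *: (fun f : L => f (x i) : R[i]^o)) f =
    \sum_(i < size s) c i * f (x i) by rewrite fct_sumE.
split; last first.
  apply/funext => f; apply: etrans (sumE (M f)) _; rewrite big1// => i _.
  have /eqP psi0 : psi (x i) == 0 by rewrite psi_zeros mem_tnth.
  by rewrite mult_operatorE psi0 mul0r mulr0.
split=> [b f g|].
  rewrite !sumE scaler_sumr -big_split; apply: eq_bigr => i _ /=.
  by rewrite [in LHS]/GRing.add/= mulrDr mulrCA.
(* Evaluation at [x i] has norm at most [1 / mu (x i)]. *)
exists (\sum_(i < size s) normc (c i) * (mu (x i))%:num^-1)%:C%C => f.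
rewrite sumE Linf_normE -rmorphM /= mulr_suml rmorph_sum /=.
apply: le_trans (ler_norm_sum _ _ _) _; apply: ler_sum => i _.
rewrite normrM !Defs.normcE -rmorphM lecR -mulrA.
by rewrite ler_wpM2l ?normc_ge0// Linf_fun_le.
Qed.

End BoundedBelow.

Lemma fredholm_multP : bounded_operator M ->
  (fredholm M <-> finite_set (zero_set psi) /\
    exists2 d : R, 0 < d & forall v, psi v != 0 -> d <= normc (psi v)).
Proof.
move=> Mb; split=> [[_ Mcl kfin _]|[/finite_seqP[s zs] [d d0 psid]]].
  by split; [exact: kernel_mult_finite|exact: closed_range_mult_lower_bound].
(* Repetitions are removed so that each indicator occurs once in the sums over the zeros. *)
have psi_zeros v : (psi v == 0) = (v \in undup s).
  rewrite mem_undup; apply/eqP/idP => [psi0|vs].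
    by have : zero_set psi v by []; rewrite zs.
  by have : [set` s] v by []; rewrite -zs.
split => //.
- exact: closed_range_mult d0 psi_zeros psid.
- exact: finite_dimensional_kernel_mult (undup_uniq s) psi_zeros.
- exact: finite_dimensional_kernel_adjoint_mult (undup_uniq s) d0 psi_zeros psid.
Qed.

End Operator.
End MultiplicationOperator.

(** * From zeros and infima to lengths *)

Theorem corollary7p10 (R : realType) (T : metricType R) (o : T)
    (T_locally_finite : locally_finite o) (T_unbounded : unbounded o)
    (mu : T -> {posnum R}) (psi : T -> R[i])
    (psi_stable : stable_under_mult mu psi)
    (psi_bounded : bounded_operator (mult_operator psi_stable)) :
  let fredholm_mult := fredholm (mult_operator psi_stable) in
  let zeros_finite_inf_pos :=
    finite_set (zero_set psi) /\
    (0 < ereal_inf [set (normc (psi v))%:E | v in ~` zero_set psi])%E in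
  let eventually_bounded_below :=
    exists (eps : R) (N : nat), 0 < eps /\
      forall v : T, N%:R < rlength o v -> eps <= normc (psi v) in
  (fredholm_mult <-> zeros_finite_inf_pos) /\
  (zeros_finite_inf_pos <-> eventually_bounded_below).
Proof.
move=> /=; split.
  rewrite (fredholm_multP _ psi_bounded) ereal_inf_gt0P.
  by split=> -[zfin [d d0 psid]]; split=> //; exists d => // v /eqP/psid.
rewrite ereal_inf_gt0P; split=> [[/finite_seqP[s zs] [d d0 psid]]|].
  (* This [N] is at least the length of every zero, so longer points are not zeros. *)
  exists d, (\max_(v <- s) Num.bound (rlength o v))%N; split=> // v Nv.
  apply: psid; rewrite zs /= => vs; move: Nv; apply/negP; rewrite -leNgt.
  apply: le_trans (ltW (archi_boundP (mdist_ge0 _ _))) _.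
  rewrite ler_nat.
  exact: (leq_bigmax_seq (F := fun v => Num.bound (rlength o v))).
move=> [eps [N [eps0 psieps]]].
(* Local finiteness concerns open balls of positive radius; [N.+1] covers the closed ball of radius
   [N], including [N = 0]. *)
have small v : ~ N%:R < rlength o v -> rlength o v < N.+1%:R.
  by move=> /negP; rewrite -leNgt => /le_lt_trans; apply; rewrite ltr_nat.
have fin : finite_set [set v | rlength o v < N.+1%:R] by apply: T_locally_finite.
split.
  apply: sub_finite_set fin => v psi0; apply: small => /psieps.
  by rewrite psi0 normc0 leNgt eps0.
(* Only finitely many nonzero values escape the bound [eps], and these have a positive lower
   bound. *)
have [||d d0 psid] := @finite_set_pos_lower_bound R T
    ([set v | rlength o v < N.+1%:R] `\` zero_set psi) (fun v => normc (psi v)).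
- exact: finite_setD.
- by move=> v [_ /eqP psiv]; rewrite /= normc_gt0.
exists (Num.min d eps) => [|v psiv]; first by rewrite lt_min d0.
rewrite ge_min; apply/orP; have [/psieps|/small vN] := pselect (N%:R < rlength o v).
  by right.
by left; apply: psid.
Qed.
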